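(* Let $R$ be $\mathbb{R}$ or $\mathbb{C}$, and let $X$ and $Y$ be arbitrary convergence spaces. For a convergence space $Z$, let $[Z,R]$ denote the set of continuous functions $Z \to R$, endowed with the continuous-convergence structure (the exponential/function space in the cartesian closed category $\mathbf{Conv}$ of convergence spaces) and with the pointwise $R$-vector-space structure, so that $[Z,R]$ is a convergence vector space. Given continuous linear functionals $\mu:[X,R]\to R$ and $\nu:[Y,R]\to R$, there is a unique continuous linear functional $\mu\otimes\nu:[X\times Y,R]\to R$ such that $$\nu\big(\lambda y.\,\mu(\lambda x.\,f(x,y))\big) \;=\; (\mu\otimes\nu)(f) \;=\; \mu\big(\lambda x.\,\nu(\lambda y.\,f(x,y))\big)$$ for all continuous functions $f:X\times Y\to R$; in particular, the functions $y\mapsto \mu(\lambda x.f(x,y))$ on $Y$ and $x\mapsto\nu(\lambda y.f(x,y))$ on $X$ are continuous. (In integral notation, writing $\int f\,d\mu$ for $\mu(f)$: $\int_y\int_x f(x,y)\,d\mu\,d\nu = \int f\,d(\mu\otimes\nu) = \int_x\int_y f(x,y)\,d\nu\,d\mu$.)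
   Context: A convergence space is a set equipped with a convergence structure (a relation between filters and points satisfying the usual axioms); continuous maps are those preserving convergence of filters. The category $\mathbf{Conv}$ of convergence spaces and continuous maps is cartesian closed, $X\times Y$ denotes the product in $\mathbf{Conv}$, and function spaces carry the continuous-convergence structure. A convergence vector space is an $R$-vector space with a convergence structure making addition and scalar multiplication continuous. The notation $\lambda x.\,g(x)$ denotes the function $x\mapsto g(x)$. *)

(* Defs.v *)
From HB Require Import structures.
From mathcomp Require Import all_boot all_order all_algebra.
From mathcomp Require Import boolp classical_sets reals.
From mathcomp.real_closed Require Import complex.
Set Implicit Arguments. Unset Strict Implicit. Unset Printing Implicit Defensive.
Import Order.TTheory GRing.Theory Num.Theory.
Local Open Scope classical_set_scope.
Local Open Scope ring_scope.

(** Filters on a type, represented as set systems (improper filter allowed). *)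
Definition is_filter {T : Type} (F : set (set T)) : Prop :=
  [/\ F setT,
      (forall A B, F A -> F B -> F (A `&` B)) &
      (forall A B, A `<=` B -> F A -> F B)].

Definition principal {T : Type} (x : T) : set (set T) := [set A | A x].

Definition fimage {A B : Type} (f : A -> B) (F : set (set A)) : set (set B) :=
  [set S | F (f @^-1` S)].

Definition conv_rel (T : Type) := set (set T) -> T -> Prop.

Record convSpace := ConvSpace {
  car :> Type;
  conv : conv_rel car;
  conv_pt : forall x : car, conv (principal x) x;
  conv_fine : forall (F G : set (set car)) (x : car),
      is_filter F -> is_filter G -> F `<=` G -> conv F x -> conv G x
}.

Definition conv_continuous {A B : Type} (cA : conv_rel A) (cB : conv_rel B)
  (f : A -> B) : Prop :=
  forall (F : set (set A)) (x : A), is_filter F -> cA F x -> cB (fimage f F) (f x).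

Definition prod_conv (X Y : convSpace) : conv_rel (X * Y) :=
  fun F p => @conv X (fimage fst F) p.1 /\ @conv Y (fimage snd F) p.2.

Definition norm_conv (K : numFieldType) : conv_rel K :=
  fun F x => forall e : K, 0 < e -> F [set y | `|y - x| < e].

Definition cfun {A : Type} (cA : conv_rel A) (K : numFieldType) :=
  {f : A -> K | conv_continuous cA (@norm_conv K) f}.

(** Evaluation image of Phi x F under (g, a) |-> g a. *)
Definition ev_filter {A : Type} {K : numFieldType} {cA : conv_rel A}
  (Phi : set (set (cfun cA K))) (F : set (set A)) : set (set K) :=
  [set S | exists (P : set (cfun cA K)) (B : set A),
      [/\ Phi P, F B & forall g a, P g -> B a -> S (sval g a)]].

Definition cc_conv {A : Type} (cA : conv_rel A) (K : numFieldType) :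
    conv_rel (cfun cA K) :=
  fun Phi g => forall (F : set (set A)) (a : A),
      is_filter F -> cA F a -> norm_conv (ev_filter Phi F) (sval g a).

(** mu is a continuous linear functional [Z, K] -> K.  mu is given as a total
    map on all functions Z -> K; only its values on continuous functions
    matter (linearity and continuity are required on [Z, K] only). *)
Definition cont_lin_functional {A : Type} (cA : conv_rel A) (K : numFieldType)
    (mu : (A -> K) -> K) : Prop :=
  [/\ (forall f g : A -> K, conv_continuous cA (@norm_conv K) f ->
         conv_continuous cA (@norm_conv K) g ->
         mu (fun z => f z + g z) = mu f + mu g),
      (forall (c : K) (f : A -> K), conv_continuous cA (@norm_conv K) f ->
         mu (fun z => c * f z) = c * mu f) &
      conv_continuous (@cc_conv _ cA K) (@norm_conv K)
        (fun g : cfun cA K => mu (sval g))].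

Definition tensor_product_property (K : numFieldType) : Prop :=
  forall (X Y : convSpace) (mu : (X -> K) -> K) (nu : (Y -> K) -> K),
    cont_lin_functional (@conv X) mu ->
    cont_lin_functional (@conv Y) nu ->
    (forall f : X * Y -> K, conv_continuous (@prod_conv X Y) (@norm_conv K) f ->
       conv_continuous (@conv Y) (@norm_conv K) (fun y => mu (fun x => f (x, y))) /\
       conv_continuous (@conv X) (@norm_conv K) (fun x => nu (fun y => f (x, y)))) /\
    exists T : (X * Y -> K) -> K,
      [/\ cont_lin_functional (@prod_conv X Y) T,
          (forall f, conv_continuous (@prod_conv X Y) (@norm_conv K) f ->
             nu (fun y => mu (fun x => f (x, y))) = T f /\
             T f = mu (fun x => nu (fun y => f (x, y)))) &
          (forall T' : (X * Y -> K) -> K,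
             cont_lin_functional (@prod_conv X Y) T' ->
             (forall f, conv_continuous (@prod_conv X Y) (@norm_conv K) f ->
                nu (fun y => mu (fun x => f (x, y))) = T' f /\
                T' f = mu (fun x => nu (fun y => f (x, y)))) ->
             forall f, conv_continuous (@prod_conv X Y) (@norm_conv K) f ->
                T' f = T f)].

(* Main.v *)
Require Import Defs.
From mathcomp Require Import all_boot all_order all_algebra.
From mathcomp Require Import boolp classical_sets reals.
From mathcomp.real_closed Require Import complex.
From mathcomp Require Import ring.

Set Implicit Arguments. Unset Strict Implicit. Unset Printing Implicit Defensive.
Import Order.TTheory GRing.Theory Num.Theory.
Local Open Scope classical_set_scope.
Local Open Scope ring_scope.

(** Both iterated functionals are continuous on [[X x Y, K]] by cartesian
    closedness, and their difference [T] kills the products [a x * b y]. A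
    continuous functional vanishes on the functions that vanish on a suitable
    finite union of members of any given cover by neighborhoods; this replaces
    compactness in a Stone-Weierstrass argument. If [f z <> f w], one of the
    sections of [f] separates [z] from [w], so bumps [q z] made of such products
    localize [f] near [f z] on the support of [T], and the partition
    [q_i * prod_(k < i) (1 - q_k)] approximates [f] there, so [T f = 0]. *)

(** * Neighborhoods in a convergence space *)

Variant neighborhood (A : Type) (cA : conv_rel A) (x : A) (U : set A) : Prop :=
  Neighborhood of forall F, is_filter F -> cA F x -> F U.

Section Neighborhood.
Variables (A : Type) (cA : conv_rel A).

Lemma neighborhoodI x U V :
  neighborhood cA x U -> neighborhood cA x V -> neighborhood cA x (U `&` V).
Proof.
move=> [hU] [hV]; split=> F fF Fx.
by case: (fF) => _ hI _; apply: hI; [exact: hU|exact: hV].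
Qed.

Lemma neighborhoodS x U V : neighborhood cA x U -> U `<=` V -> neighborhood cA x V.
Proof. by move=> [hU] UV; split=> F fF Fx; case: (fF) => _ _ hS; apply: hS UV _; exact: hU. Qed.

Lemma neighborhoodT x : neighborhood cA x setT.
Proof. by split=> F []. Qed.

End Neighborhood.

(** * Continuous scalar functions and bumps *)

Section ContinuousScalar.
Variables (K : numFieldType) (A : Type) (cA : conv_rel A).
Local Notation cts := (conv_continuous cA (@norm_conv K)).

(** The convergence on [K] comes from a topology, so testing on neighborhoods suffices, although the
    neighborhoods of [x] need not form a filter converging to [x]. *)
Lemma neighborhood_continuous (f : A -> K) :
  (forall x e, 0 < e -> neighborhood cA x [set y | `|f y - f x| < e]) -> cts f.
Proof. by move=> cf F x fF Fx e e0; case: (cf x e e0) => h; exact: h. Qed.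

Lemma continuous_neighborhood (f : A -> K) x e : cts f -> 0 < e ->
  neighborhood cA x [set y | `|f y - f x| < e].
Proof. by move=> cf e0; split=> F fF Fx; exact: (cf F x fF Fx e e0). Qed.

Lemma continuous_cst (c : K) : cts (fun=> c).
Proof.
apply: neighborhood_continuous => x e e0; apply: (neighborhoodS (neighborhoodT cA x)).
by move=> y _ /=; rewrite subrr normr0.
Qed.

Lemma continuous_add (f g : A -> K) : cts f -> cts g -> cts (fun z => f z + g z).
Proof.
move=> cf cg.
apply: neighborhood_continuous => x e e0; have e2 : 0 < e / 2 by rewrite divr_gt0.
apply: (neighborhoodS (neighborhoodI (continuous_neighborhood x cf e2)
  (continuous_neighborhood x cg e2))) => y /= [h1 h2].
rewrite [e]splitr (_ : _ - _ = (f y - f x) + (g y - g x)); last by ring.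
exact: le_lt_trans (ler_normD _ _) (ltrD h1 h2).
Qed.

Lemma continuous_mul (f g : A -> K) : cts f -> cts g -> cts (fun z => f z * g z).
Proof.
move=> cf cg.
apply: neighborhood_continuous => x e e0.
(* The error is at most [d * d + |f x| * d + |g x| * d]. For [d < 1] this is at most [d * m], and
   [d = e / (e + m)] gives both [d < 1] and [d * m < e]. *)
pose m := 1 + `|f x| + `|g x|; have m0 : 0 < m by rewrite !ltr_wpDr.
have em0 : 0 < e + m by rewrite addr_gt0.
pose d := e / (e + m); have d0 : 0 < d by rewrite divr_gt0.
have d1 : d < 1 by rewrite ltr_pdivrMr// mul1r ltrDl.
apply: (neighborhoodS (neighborhoodI (continuous_neighborhood x cf d0)
  (continuous_neighborhood x cg d0))) => y /= [h1 h2].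
rewrite (_ : _ - _ = (f y - f x) * (g y - g x) + f x * (g y - g x) + g x * (f y - f x));
  last by ring.
apply: (@le_lt_trans _ _ (d * m)).
  rewrite (_ : d * m = 1 * d + `|f x| * d + `|g x| * d); last by rewrite /m; ring.
  apply: le_trans (ler_normD _ _) _; apply: lerD; last first.
    by rewrite normrM ler_wpM2l// ltW.
  apply: le_trans (ler_normD _ _) _; apply: lerD; last first.
    by rewrite normrM ler_wpM2l// ltW.
  by rewrite normrM ler_pM// ltW// (lt_trans h1).
by rewrite /d mulrAC ltr_pdivrMr// ltr_pM2l// ltrDr.
Qed.

Lemma continuous_sub (f g : A -> K) : cts f -> cts g -> cts (fun z => f z - g z).
Proof.
move=> cf cg.
have -> : (fun z => f z - g z) = fun z => f z + (-1) * g z.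
  by apply/funext => z; rewrite mulN1r.
by apply: continuous_add => //; apply: continuous_mul => //; exact: continuous_cst.
Qed.

Lemma continuous_norm (f : A -> K) : cts f -> cts (fun z => `|f z|).
Proof.
move=> cf; apply: neighborhood_continuous => x e e0.
apply: (neighborhoodS (continuous_neighborhood x cf e0)) => y /=.
exact: le_lt_trans (ler_dist_dist _ _).
Qed.

(* [min 1 (max 0 t)] on real [t], written with norms so that it is continuous
   on all of [K] *)
Definition clamp (t : K) : K :=
  let m := (t + `|t|) / 2 in (1 + m - `|1 - m|) / 2.

Lemma clamp_le0 t : t <= 0 -> clamp t = 0.
Proof. by move=> t0; rewrite /clamp ler0_norm// subrr mul0r addr0 subr0 normr1 subrr mul0r. Qed.

Lemma clamp_ge0 t : 0 <= t -> clamp t = (1 + t - `|1 - t|) / 2.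
Proof. by move=> t0; rewrite /clamp ger0_norm// (_ : (t + t) / 2 = t)//; field. Qed.

Lemma clamp_ge1 t : 1 <= t -> clamp t = 1.
Proof.
by move=> t1; rewrite clamp_ge0 ?(le_trans ler01)// ler0_norm ?subr_le0//; field.
Qed.

Lemma clamp_itv t : t \is Num.real -> 0 <= clamp t <= 1.
Proof.
move=> tR; have [t0|/ltW t0] := real_leP tR (real0 K); first by rewrite clamp_le0// lexx ler01.
have [t1|/ltW t1] := real_leP (real1 K) tR; first by rewrite clamp_ge1// ler01 lexx.
by rewrite clamp_ge0// ger0_norm ?subr_ge0// (_ : _ / 2 = t) ?t0//; field.
Qed.

Lemma continuous_clamp (f : A -> K) : cts f -> cts (fun z => clamp (f z)).
Proof.
move=> cf; have ch : cts (fun z => (f z + `|f z|) / 2).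
  by apply: continuous_mul (continuous_cst _); apply: continuous_add => //; exact: continuous_norm.
apply: continuous_mul (continuous_cst _); apply: continuous_sub.
  by apply: continuous_add => //; exact: continuous_cst.
by apply: continuous_norm; apply: continuous_sub => //; exact: continuous_cst.
Qed.

Lemma separating_bump (a : A -> K) x y : cts a -> a x != a y ->
  exists p : A -> K, [/\ cts p, (forall z, 0 <= p z <= 1),
    neighborhood cA x [set z | p z = 1] & neighborhood cA y [set z | p z = 0]].
Proof.
move=> ca axy; pose d := `|a x - a y|; have d0 : 0 < d by rewrite normr_gt0 subr_eq0.
have d3 : 0 < d / 3 by rewrite divr_gt0.
have d3' : d / 3 != 0 by rewrite gt_eqF.
(* The clamped argument is at least 1 once [|a z - a y| >= 2 * d / 3], which holds near [x], and at
   most 0 once [|a z - a y| <= d / 3], which holds near [y]. *)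
exists (fun z => clamp (`|a z - a y| / (d / 3) - 1)); split.
- apply: continuous_clamp; apply: continuous_sub (continuous_cst _).
  apply: continuous_mul (continuous_cst _); apply: continuous_norm.
  exact: continuous_sub (continuous_cst _).
- move=> z; apply: clamp_itv; rewrite realB// ger0_real//.
  by rewrite divr_ge0// ltW.
- apply: (neighborhoodS (continuous_neighborhood x ca d3)) => z /= hz; apply: clamp_ge1.
  rewrite lerBrDr ler_pdivlMr//.
  have : d <= `|a z - a y| + d / 3.
    apply: (@le_trans _ _ (`|a z - a y| + `|a z - a x|)); last by rewrite lerD2l ltW.
    by rewrite /d (_ : a x - a y = (a z - a y) - (a z - a x)) ?ler_normB//; ring.
  rewrite -lerBlDr; apply: le_trans.
  by rewrite (_ : (1 + 1) * (d / 3) = d - d / 3) ?lexx//; field.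
- apply: (neighborhoodS (continuous_neighborhood y ca d3)) => z /= hz; apply: clamp_le0.
  by rewrite subr_le0 ler_pdivrMr// mul1r ltW.
Qed.

End ContinuousScalar.

(** * Continuous linear functionals: boundedness and support *)

Section Functional.
Variables (K : numFieldType) (A : Type) (cA : conv_rel A) (T : (A -> K) -> K).
Hypothesis HT : cont_lin_functional cA T.
Local Notation cts := (conv_continuous cA (@norm_conv K)).

Lemma functionalD f g : cts f -> cts g -> T (fun z => f z + g z) = T f + T g.
Proof. by case: HT => h _ _; exact: h. Qed.

Lemma functionalZ c f : cts f -> T (fun z => c * f z) = c * T f.
Proof. by case: HT => _ h _; exact: h. Qed.

Lemma functional0 : T (fun=> 0) = 0.
Proof.
rewrite -[RHS](mul0r (T (fun=> 0))) -functionalZ; last exact: continuous_cst.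
by congr T; apply/funext => z; rewrite mul0r.
Qed.

Lemma functionalB f g : cts f -> cts g -> T (fun z => f z - g z) = T f - T g.
Proof.
move=> cf cg; have cN : cts (fun z => -1 * g z).
  by apply: continuous_mul => //; exact: continuous_cst.
rewrite -[- T g]mulN1r -functionalZ// -functionalD//.
by congr T; apply/funext => z; rewrite mulN1r.
Qed.

(** Continuity of [T] at 0: the second hypothesis unfolds continuous convergence of [Phi] to the
    zero function. Radius 1 is enough, since linearity allows rescaling. *)
Lemma functional_continuous0 (Phi : set (set (cfun cA K))) : is_filter Phi ->
  (forall F a, is_filter F -> cA F a -> forall e, 0 < e ->
     exists P B, [/\ Phi P, F B & forall g z, P g -> B z -> `|sval g z| < e]) ->
  Phi [set g | `|T (sval g)| < 1].
Proof.
move=> fPhi hPhi; case: HT => _ _ cT.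
have := cT Phi (exist _ _ (@continuous_cst _ _ cA 0)) fPhi.
have h : cc_conv Phi (exist _ _ (@continuous_cst K _ cA 0)).
  move=> F a fF Fa e e0; have [P [B [hP hB hPB]]] := hPhi F a fF Fa e e0.
  by exists P, B; split=> // g z Pg Bz /=; rewrite subr0; exact: hPB.
move=> /(_ h 1 ltr01); rewrite /fimage /= functional0; case: fPhi => _ _; apply.
by move=> g /=; rewrite subr0.
Qed.

(** The filter generated by the uniform balls around 0 converges continuously to 0, so [T] maps some
    ball of radius [e] into the unit disc; rescaling gives [C = e^-1]. *)
Lemma functional_bounded : exists2 C : K, 0 < C & forall (f : A -> K) s, cts f ->
  0 < s -> (forall z, `|f z| <= s) -> `|T f| <= C * s.
Proof.
pose Phi : set (set (cfun cA K)) :=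
  [set P | exists2 e : K, 0 < e & forall g, (forall z, `|sval g z| <= e) -> P g].
have fPhi : is_filter Phi.
  split; first by exists 1.
  (* A positive radius below both [e] and [d], obtained without comparing them. *)
  - move=> P Q [e e0 hP] [d d0 hQ]; exists (e * d / (e + d)).
      by rewrite divr_gt0 ?mulr_gt0 ?addr_gt0.
    move=> g hg; split; [apply: hP|apply: hQ] => z; apply: le_trans (hg z) _.
    + by rewrite ler_pdivrMr ?addr_gt0// ler_pM2l// lerDr ltW.
    + by rewrite ler_pdivrMr ?addr_gt0// mulrC ler_pM2l// lerDl ltW.
  - by move=> P Q PQ [e e0 hP]; exists e => // g hg; apply/PQ/hP.
have [] : Phi [set g | `|T (sval g)| < 1].
  apply: functional_continuous0 => // F a [FT _ _] _ e e0.
  exists [set g | forall z, `|sval g z| <= e / 2], setT; split=> //.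
    by exists (e / 2) => //; rewrite divr_gt0.
  by move=> g z /(_ z) hg _; apply: le_lt_trans hg _; rewrite ltr_pdivrMr// ltr_pMr// ltr1n.
move=> e e0 he; exists e^-1; first by rewrite invr_gt0.
move=> f s cf s0 hf; have cg : cts (fun z => e / s * f z).
  by apply: continuous_mul => //; exact: continuous_cst.
have es0 : 0 < e / s by rewrite divr_gt0.
have /= := he (exist _ _ cg); rewrite functionalZ// normrM gtr0_norm//.
have hb z : `|e / s * f z| <= e.
  by rewrite normrM gtr0_norm// mulrAC ler_pdivrMr// ler_pM2l.
move=> /(_ hb) /ltW; rewrite -ler_pdivlMl// mulr1 invf_div mulrC; exact.
Qed.

(* The filter generated by the sets [{g | g = 0 on U w for w in s}], [s] finite,
   converges to 0 in the function space. *)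
Lemma functional_support (U : A -> set A) : (forall w, neighborhood cA w (U w)) ->
  exists s : seq A, forall g, cts g ->
    (forall w z, List.In w s -> U w z -> g z = 0) -> T g = 0.
Proof.
move=> hU; pose Phi : set (set (cfun cA K)) := [set P | exists s : seq A,
  forall g, (forall w z, List.In w s -> U w z -> sval g z = 0) -> P g].
have fPhi : is_filter Phi.
  split; first by exists [::].
  - move=> P Q [s hP] [t hQ]; exists (s ++ t) => g hg.
    by split; [apply: hP|apply: hQ] => w z ws; apply: (hg w);
      apply/List.in_or_app; [left|right].
  - by move=> P Q PQ [s hP]; exists s => // g hg; apply/PQ/hP.
have [] : Phi [set g | `|T (sval g)| < 1].
  apply: functional_continuous0 => // F a fF Fa e e0.
  (* A filter converging to [a] contains [U a], so the one-point list [[:: a]] already makes the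
     evaluations vanish. *)
  exists [set g | forall z, U a z -> sval g z = 0], (U a); split.
  - by exists [:: a] => g hg z; apply: hg; left.
  - by case: (hU a) => h; exact: h.
  - by move=> g z hg Uz; rewrite hg// normr0.
move=> s hs; exists s => g cg g0; apply: contrapT => /eqP Tg.
(* Rescaling keeps the zeros of [g] but would give [T] the value 1, which is not below 1. *)
have cg' : cts (fun z => (T g)^-1 * g z).
  by apply: continuous_mul => //; exact: continuous_cst.
have : `|T (fun z => (T g)^-1 * g z)| < 1.
  by apply: (hs (exist _ _ cg')) => w z ws Uz /=; rewrite (g0 w)// mulr0.
by rewrite functionalZ// mulVf// normr1 ltxx.
Qed.

End Functional.

(** * A Stone-Weierstrass argument for functionals *)

Section StoneWeierstrass.
Variables (K : numFieldType) (A : Type) (cA : conv_rel A) (T : (A -> K) -> K).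
Hypothesis HT : cont_lin_functional cA T.
Local Notation cts := (conv_continuous cA (@norm_conv K)).

Variable alg : set (A -> K).
Hypothesis alg_continuous : forall g, alg g -> cts g.
Hypothesis alg_cst : forall c, alg (fun=> c).
Hypothesis algB : forall g h, alg g -> alg h -> alg (fun z => g z - h z).
Hypothesis algM : forall g h, alg g -> alg h -> alg (fun z => g z * h z).
Hypothesis T_alg : forall g, alg g -> T g = 0.

(** A finite product stays in [alg], inherits the zeros of each factor, and equals 1 on a finite
    intersection of neighborhoods of [z]. *)
Lemma prod_bump (z : A) (p : A -> A -> K) (s : seq A) :
  (forall w, [/\ alg (p w), (forall v, 0 <= p w v <= 1) &
                 neighborhood cA z [set v | p w v = 1]]) ->
  exists q, [/\ alg q, (forall v, 0 <= q v <= 1),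
    neighborhood cA z [set v | q v = 1] &
    forall w v, List.In w s -> p w v = 0 -> q v = 0].
Proof.
move=> hp; elim: s => [|w s [q [aq q01 qz qs]]].
  exists (fun=> 1); split=> //; first by move=> v; rewrite ler01 lexx.
  by apply: (neighborhoodS (neighborhoodT cA z)).
have [ap p01 pz] := hp w; exists (fun v => p w v * q v); split.
- exact: algM.
- move=> v; have /andP[p0 p1] := p01 v; have /andP[q0 q1] := q01 v.
  by rewrite mulr_ge0//= mulr_ile1.
- by apply: (neighborhoodS (neighborhoodI pz qz)) => v /= [-> ->]; rewrite mulr1.
- move=> u v /= [<- ->|us pu]; first by rewrite mul0r.
  by rewrite (qs u v us pu) mulr0.
Qed.

Variable f : A -> K.
Hypothesis cf : cts f.
Hypothesis alg_separates : forall z w, f z <> f w -> exists p,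
  [/\ alg p, (forall v, 0 <= p v <= 1),
      neighborhood cA z [set v | p v = 1] & neighborhood cA w [set v | p v = 0]].

(** Each [w] has a neighborhood on which [f] is [e]-close to [f z] (if [f w = f z]) or a bump [p w]
    vanishes (otherwise). Finitely many of these neighborhoods control [T], and [q] is the product
    of the corresponding bumps. *)
Lemma localizing_bump (e : K) (z : A) : 0 < e -> exists q,
  [/\ alg q, (forall v, 0 <= q v <= 1), neighborhood cA z [set v | q v = 1] &
    forall g, cts g -> (forall v, `|f v - f z| < e \/ q v = 0 -> g v = 0) -> T g = 0].
Proof.
move=> e0; have : forall w, exists p, [/\ alg p, (forall v, 0 <= p v <= 1),
    neighborhood cA z [set v | p v = 1] &
    neighborhood cA w [set v | `|f v - f z| < e \/ p v = 0]].
  move=> w; have [fzw|/alg_separates[p [ap p01 pz pw]]] := pselect (f z = f w).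
    exists (fun=> 1); split=> //; first by move=> v; rewrite ler01 lexx.
      by apply: (neighborhoodS (neighborhoodT cA z)).
    by rewrite fzw; apply: (neighborhoodS (continuous_neighborhood w cf e0)) => v; left.
  by exists p; split=> //; apply: (neighborhoodS pw) => v; right.
move=> /choice[p hp]; have [|s hs] := functional_support HT
  (U := fun w => [set v | `|f v - f z| < e \/ p w v = 0]).
  by move=> w; have [] := hp w.
have [|q [aq q01 qz qs]] := @prod_bump z p s; first by move=> w; have [] := hp w.
exists q; split=> // g cg hg; apply: hs => // w v ws /= [fv|pv]; apply: hg.
  by left.
by right; exact: qs pv.
Qed.

(* [h] is the error of the approximation [\sum_i f z_i q_i \prod_(k < i) (1 - q_k)]
   of [f] by elements of [alg], cut off where it is large, [r] is
   [\prod_i (1 - q_i)]. *)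
Lemma functional_partition (e : K) (q : A -> A -> K) (s : seq A) : 0 < e ->
  (forall z, [/\ alg (q z), (forall v, 0 <= q z v <= 1) &
    forall g, cts g -> (forall v, `|f v - f z| < e \/ q z v = 0 -> g v = 0) ->
      T g = 0]) ->
  exists r h, [/\ alg r /\ (forall v, 0 <= r v <= 1),
    (forall z v, List.In z s -> q z v = 1 -> r v = 0), cts h,
    (forall v, `|h v| <= 2 * e * (1 - r v)) &
    T (fun v => f v * (1 - r v)) = T h].
Proof.
move=> e0 hq; elim: s => [|z s [r [h [[ar r01] rs ch hr Tr]]]].
  exists (fun=> 1), (fun=> 0); split=> //.
  - by split=> // v; rewrite ler01 lexx.
  - exact: continuous_cst.
  - by move=> v; rewrite normr0 subrr mulr0.
  - by congr T; apply/funext => v; rewrite subrr mulr0.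
have [aq q01 qT] := hq z.
have cq := alg_continuous aq; have cr := alg_continuous ar.
have cqr := continuous_mul cq cr.
have cfz : cts (fun v => f v - f z) by apply: continuous_sub => //; exact: continuous_cst.
(* The cutoff is 1 where [|f v - f z| <= e] and 0 where it is at least [2 * e], so [(f - f z) * c]
   is bounded by [2 * e] everywhere, even if [f] is unbounded. *)
pose c v := clamp (2 - `|f v - f z| / e).
have cc : cts c.
  apply: continuous_clamp; apply: continuous_sub; first exact: continuous_cst.
  by apply: continuous_mul; [exact: continuous_norm|exact: continuous_cst].
have dR v : 2 - `|f v - f z| / e \is Num.real.
  by rewrite realB// ger0_real// divr_ge0// ltW.
have c01 v : 0 <= c v <= 1 by exact: clamp_itv.
have c1 v : `|f v - f z| < e -> c v = 1.
  move=> fv; apply: clamp_ge1; rewrite lerBrDr -lerBrDl.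
  by rewrite ler_pdivrMr// (_ : 2 - 1 = 1 :> K) ?mul1r ?ltW//; ring.
have fc v : `|(f v - f z) * c v| <= 2 * e.
  have /andP[c0 cle1] := c01 v; rewrite normrM (ger0_norm c0).
  have [fv|fv] := real_leP (normr_real (f v - f z)) 
    (ger0_real (mulr_ge0 (ler0n K 2) (ltW e0))).
    by rewrite -[leRHS]mulr1 ler_pM.
  rewrite /c clamp_le0; first by rewrite mulr0 mulr_ge0// ltW.
  by rewrite subr_le0 ler_pdivlMr// ltW.
pose k v := (f v - f z) * c v * (q z v * r v).
have ck : cts k by apply: continuous_mul => //; exact: continuous_mul.
(* Passing from [r] to [(1 - q z) * r] increases [1 - r] by [q z * r], the weight carried by the new
   error [k]; this keeps the bound on [h] telescoping. *)
exists (fun v => (1 - q z v) * r v), (fun v => h v + k v); split.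
- split; first by apply: algM => //; exact: algB.
  move=> v; have /andP[r0 r1] := r01 v; have /andP[q0 q1] := q01 v.
  by rewrite mulr_ge0 ?subr_ge0//= mulr_ile1 ?subr_ge0// gerBl.
- by move=> u v /= [<- ->|us qu]; rewrite ?subrr ?mul0r// (rs u v us qu) mulr0.
- exact: continuous_add.
- move=> v; have /andP[r0 r1] := r01 v; have /andP[q0 q1] := q01 v.
  rewrite (_ : 2 * e * _ = 2 * e * (1 - r v) + 2 * e * (q z v * r v)); last by ring.
  apply: le_trans (ler_normD _ _) _; apply: lerD => //.
  rewrite /k normrM (ger0_norm (mulr_ge0 q0 r0)) ler_wpM2r//.
  exact: mulr_ge0.
- have c1r : cts (fun v => 1 - r v) by apply: continuous_sub => //; exact: continuous_cst.
  have cfqr : cts (fun v => (f v - f z) * (q z v * r v)) by exact: continuous_mul.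
  have -> : (fun v => f v * (1 - (1 - q z v) * r v)) =
      fun v => (f v * (1 - r v)) + ((f v - f z) * (q z v * r v) + f z * (q z v * r v)).
    by apply/funext => v; ring.
  have cz : cts (fun v => f z * (q z v * r v)).
    by apply: continuous_mul => //; exact: continuous_cst.
  rewrite !(functionalD HT)//; first last.
  - exact: continuous_add.
  - exact: continuous_mul.
  rewrite Tr [T (fun v => f z * _)]T_alg ?addr0; last first.
    by apply: algM => //; exact: algM.
  (* The cutoff does not change the value of [T]: the discarded part vanishes where [c = 1] and
     where [q z = 0], so the localization of [q z] applies. *)
  congr (_ + _); apply/eqP; rewrite -subr_eq0 -(functionalB HT)//; apply/eqP.
  apply: qT; first exact: continuous_sub.
  by move=> v [/c1|] E; rewrite /k E; ring.
Qed.

Lemma functional_Stone_Weierstrass : T f = 0.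
Proof.
have [C C0 hC] := functional_bounded HT.
apply: contrapT => /eqP Tf; have Tf0 : 0 < `|T f| by rewrite normr_gt0.
(* Chosen so that [C * (2 * e)], the bound for [T h = T f], is half of [|T f|]. *)
pose e := `|T f| / (4 * C); have e0 : 0 < e by rewrite divr_gt0 ?mulr_gt0.
have /choice[q hq] := fun z => localizing_bump z e0.
(* A second use of the support property, now for the sets [q z = 1]: the remainder [r] vanishes on
   the finitely many selected ones, so [T] kills [f * r]. *)
have [|s hs] := functional_support HT (U := fun z => [set v | q z v = 1]).
  by move=> z; have [] := hq z.
have [|r [h [[ar r01] rs ch hr Tr]]] := @functional_partition e q s e0.
  by move=> z; have [] := hq z.
have cr := alg_continuous ar.
have c1r : cts (fun v => 1 - r v) by apply: continuous_sub => //; exact: continuous_cst.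
have TfE : T f = T h.
  rewrite -Tr; apply/eqP; rewrite -subr_eq0 -(functionalB HT)//; last exact: continuous_mul.
  apply/eqP/hs; first by apply: continuous_sub => //; exact: continuous_mul.
  by move=> w v ws qv; rewrite (rs w v ws qv); ring.
have := hC h (2 * e) ch; rewrite -TfE mulr_gt0// => /(_ isT).
have -> : C * (2 * e) = `|T f| / 2 by rewrite /e; field; rewrite gt_eqF.
suff h2 v : `|h v| <= 2 * e.
  by move=> /(_ h2); rewrite ler_pdivlMr// ger_pMr// lern1.
apply: le_trans (hr v) _; have /andP[r0 _] := r01 v.
by rewrite ler_piMr ?gerBl// mulr_ge0// ltW.
Qed.

End StoneWeierstrass.

(** * Iterated functionals and cartesian closedness *)

Section Iterated.
Variables (K : numFieldType) (A B Z : Type).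
Variables (cA : conv_rel A) (cB : conv_rel B) (cZ : conv_rel Z).
(** An abstract pairing serves both orders of integration: it is later either the pairing into
    [X * Y] or its flip. *)
Variable pair : A -> B -> Z.

(** The image under [p] of the product filter, generated by images of rectangles. *)
Definition filter_prod (C D E : Type) (p : C -> D -> E) (F : set (set C))
    (G : set (set D)) : set (set E) :=
  [set S | exists U V, [/\ F U, G V & forall a b, U a -> V b -> S (p a b)]].

Lemma filter_prod_filter (C D E : Type) (p : C -> D -> E) F G :
  is_filter F -> is_filter G -> is_filter (filter_prod p F G).
Proof.
move=> [FT FI FS] [GT GI GS]; split.
- by exists setT, setT.
- move=> S S' [U [V [FU GV h]]] [U' [V' [FU' GV' h']]].
  exists (U `&` U'), (V `&` V'); split; [exact: FI|exact: GI|].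
  by move=> a b [? ?] [? ?]; split; [exact: h|exact: h'].
- by move=> S S' SS' [U [V [FU GV h]]]; exists U, V; split=> // a b Ua Vb; exact/SS'/h.
Qed.

Lemma principal_filter (C : Type) (x : C) : is_filter (principal x).
Proof. by split=> // S S' SS'; exact: SS'. Qed.

Lemma fimage_filter (C D : Type) (f : C -> D) F : is_filter F -> is_filter (fimage f F).
Proof.
move=> [FT FI FS]; split=> //; first by move=> S S' hS hS'; exact: FI.
by move=> S S' SS'; apply: FS => x; exact: SS'.
Qed.

Hypothesis pair_continuous : forall F G a b, is_filter F -> is_filter G ->
  cA F a -> cB G b -> cZ (filter_prod pair F G) (pair a b).
Hypothesis cB_pt : forall b, cB (principal b) b.

Local Notation cts c := (conv_continuous c (@norm_conv K)).

Lemma continuous_section (f : Z -> K) b : cts cZ f -> cts cA (fun a => f (pair a b)).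
Proof.
move=> cf F a fF Fa e e0.
have pb := principal_filter b.
have [U [V [FU Vb h]]] :=
  cf _ _ (filter_prod_filter pair fF pb) (pair_continuous fF pb Fa (cB_pt b)) e e0.
by case: fF => _ _ FS; apply: FS FU => x Ux; exact: h.
Qed.

Variables (mu : (A -> K) -> K) (nu : (B -> K) -> K).
Hypothesis Hmu : cont_lin_functional cA mu.
Hypothesis Hnu : cont_lin_functional cB nu.

Definition fsection (f : cfun cZ K) (b : B) : cfun cA K :=
  exist _ _ (@continuous_section (sval f) b (svalP f)).

(** Joint continuity of partial application: evaluating sections along [F] amounts to evaluating
    [Phi] along the product of [F] and [G], which converges in [Z]. *)
Lemma fsection_continuous (Phi : set (set (cfun cZ K))) G f b :
  is_filter Phi -> is_filter G -> cc_conv Phi f -> cB G b ->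
  cc_conv (filter_prod fsection Phi G) (fsection f b).
Proof.
move=> fPhi fG Phif Gb F a fF Fa e e0.
have [P [W [PhiP [U [V [FU GV UV]]] PW]]] :=
  Phif _ _ (filter_prod_filter pair fF fG) (pair_continuous fF fG Fa Gb) e e0.
exists [set g | exists2 g', P g' & exists2 b', V b' & g = fsection g' b'], U; split=> //.
  by exists P, V; split=> // g' b' ? ?; exists g' => //; exists b'.
by move=> _ x [g Pg [b' Vb' ->]] Ux; apply: PW => //; exact: UV.
Qed.

Lemma mu_section_continuous (Phi : set (set (cfun cZ K))) G f b :
  is_filter Phi -> is_filter G -> cc_conv Phi f -> cB G b ->
  forall e, 0 < e -> exists P V, [/\ Phi P, G V & forall g b', P g -> V b' ->
    `|mu (sval (fsection g b')) - mu (sval (fsection f b))| < e].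
Proof.
move=> fPhi fG Phif Gb e e0; case: Hmu => _ _ cmu.
exact: (cmu _ _ (filter_prod_filter fsection fPhi fG)
  (fsection_continuous fPhi fG Phif Gb) e e0).
Qed.

Lemma continuous_partial (f : Z -> K) :
  cts cZ f -> cts cB (fun b => mu (fun a => f (pair a b))).
Proof.
move=> cf G b fG Gb e e0; pose f' : cfun cZ K := exist _ f cf.
(* On the singleton [[set f']], continuous convergence reduces to continuity of [f]. *)
have h : cc_conv (principal f') f'.
  move=> F z fF Fz d d0; exists [set f'], [set y | `|f y - f z| < d]; split=> //.
    exact: (cf F z fF Fz d d0).
  by move=> g y ->.
have [P [V [Pf GV hPV]]] := mu_section_continuous (principal_filter f') fG h Gb e0.
by case: fG => _ _ GS; apply: GS GV => y Vy; exact: (hPV f' y Pf Vy).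
Qed.

Lemma iterated_functional :
  cont_lin_functional cZ (fun f => nu (fun b => mu (fun a => f (pair a b)))).
Proof.
split.
- move=> f g cf cg; rewrite -(functionalD Hnu); [|exact: continuous_partial..].
  congr nu; apply/funext => b.
  by rewrite -(functionalD Hmu)//; exact: continuous_section.
- move=> c f cf; rewrite -(functionalZ Hnu); last exact: continuous_partial.
  congr nu; apply/funext => b.
  by rewrite -(functionalZ Hmu)//; exact: continuous_section.
- move=> Phi f fPhi Phif.
  (* The functional is [nu] after [part], and joint continuity in the function and the point is what
     makes [part] continuous into [[B, K]]. *)
  pose part (g : cfun cZ K) : cfun cB K := exist _ _ (continuous_partial (svalP g)).
  case: Hnu => _ _ cnu.
  apply: (cnu (fimage part Phi) (part f) (fimage_filter part fPhi)).
  move=> G b fG Gb e e0.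
  have [P [V [PhiP GV hPV]]] := mu_section_continuous fPhi fG Phif Gb e0.
  exists [set g | exists2 g', P g' & g = part g'], V; split=> //.
    by case: fPhi => _ _ PhiS; apply: PhiS PhiP => g Pg; exists g.
  by move=> _ y [g Pg ->] Vy; exact: hPV.
Qed.

End Iterated.

(** * Interchange of the two functionals and the tensor product *)

Lemma functional_sub (K : numFieldType) (A : Type) (cA : conv_rel A)
    (S T : (A -> K) -> K) :
  cont_lin_functional cA S -> cont_lin_functional cA T ->
  cont_lin_functional cA (fun f => S f - T f).
Proof.
move=> HS HT; split.
- by move=> f g cf cg; rewrite (functionalD HS)// (functionalD HT)//; ring.
- by move=> c f cf; rewrite (functionalZ HS)// (functionalZ HT)//; ring.
- case: HS => _ _ cS; case: HT => _ _ cT.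
  exact: (continuous_sub (f := fun g : cfun cA K => S (sval g)) cS cT).
Qed.

Section Fubini.
Variables (K : numFieldType) (X Y : convSpace).
Variables (mu : (X -> K) -> K) (nu : (Y -> K) -> K).
Hypothesis Hmu : cont_lin_functional (@conv X) mu.
Hypothesis Hnu : cont_lin_functional (@conv Y) nu.
Local Notation cts c := (conv_continuous c (@norm_conv K)).
Local Notation cXY := (@prod_conv X Y).

Lemma pair_continuous F G (x : X) (y : Y) : is_filter F -> is_filter G ->
  conv F x -> conv G y -> cXY (filter_prod pair F G) (x, y).
Proof.
move=> fF fG Fx Gy; have fP := filter_prod_filter pair fF fG; split.
- apply: conv_fine fF (fimage_filter fst fP) _ Fx => U FU.
  by exists U, setT; split=> //; case: fG.
- apply: conv_fine fG (fimage_filter snd fP) _ Gy => V GV.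
  by exists setT, V; split=> //; case: fF.
Qed.

Lemma pair_continuousC F G (y : Y) (x : X) : is_filter F -> is_filter G ->
  conv F y -> conv G x -> cXY (filter_prod (fun y x => (x, y)) F G) (x, y).
Proof.
move=> fF fG Fy Gx; have fP := filter_prod_filter (fun (y : Y) (x : X) => (x, y)) fF fG.
split.
- apply: conv_fine fG (fimage_filter fst fP) _ Gx => U GU.
  by exists setT, U; split=> //; case: fF.
- apply: conv_fine fF (fimage_filter snd fP) _ Fy => V FV.
  by exists V, setT; split=> //; case: fG.
Qed.

Lemma continuous_fst (a : X -> K) : cts (@conv X) a -> cts cXY (fun z => a z.1).
Proof. by move=> ca F z fF [F1 _]; exact: (ca _ _ (fimage_filter fst fF) F1). Qed.

Lemma continuous_snd (b : Y -> K) : cts (@conv Y) b -> cts cXY (fun z => b z.2).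
Proof. by move=> cb F z fF [_ F2]; exact: (cb _ _ (fimage_filter snd fF) F2). Qed.

Lemma neighborhood_fst (z : X * Y) U : neighborhood (@conv X) z.1 U ->
  neighborhood cXY z [set v | U v.1].
Proof. by move=> [hU]; split=> F fF [F1 _]; exact: (hU _ (fimage_filter fst fF)). Qed.

Lemma neighborhood_snd (z : X * Y) U : neighborhood (@conv Y) z.2 U ->
  neighborhood cXY z [set v | U v.2].
Proof. by move=> [hU]; split=> F fF [_ F2]; exact: (hU _ (fimage_filter snd fF)). Qed.

Lemma fubini (f : X * Y -> K) : cts cXY f ->
  nu (fun y => mu (fun x => f (x, y))) = mu (fun x => nu (fun y => f (x, y))).
Proof.
move=> cf; apply/eqP; rewrite -subr_eq0; apply/eqP.
pose T g := nu (fun y => mu (fun x => g (x, y))) - mu (fun x => nu (fun y => g (x, y))).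
have HT : cont_lin_functional cXY T.
  apply: functional_sub.
    exact: (iterated_functional pair_continuous (@conv_pt Y) Hmu Hnu).
  exact: (iterated_functional pair_continuousC (@conv_pt X) Hnu Hmu).
rewrite -[LHS]/(T f).
(* Quantifying over all factors [a] and [b] makes [N] stable under multiplication by functions of
   one variable. *)
pose N (k : X * Y -> K) := cts cXY k /\ forall a b, cts (@conv X) a -> cts (@conv Y) b ->
  T (fun z => a z.1 * b z.2 * k z) = 0.
(* The multipliers of [N] form an algebra containing the continuous functions
   of either variable, which spares describing the algebra they generate. *)
pose alg g := cts cXY g /\ forall k, N k -> N (fun z => g z * k z).
have cab a b : cts (@conv X) a -> cts (@conv Y) b -> cts cXY (fun z => a z.1 * b z.2).
  by move=> ca cb; apply: continuous_mul; [exact: continuous_fst|exact: continuous_snd].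
(* On a product [a x * b y] both iterated functionals give [mu a * nu b]. *)
have N1 : N (fun=> 1).
  split=> [|a b ca cb]; first exact: continuous_cst.
  rewrite /T /=; apply/eqP; rewrite subr_eq0; apply/eqP.
  have -> : (fun y => mu (fun x => a x * b y * 1)) = fun y => mu a * b y.
    apply/funext => y; rewrite mulrC -(functionalZ Hmu)//.
    by congr mu; apply/funext => x; rewrite mulr1 mulrC.
  have -> : (fun x => nu (fun y => a x * b y * 1)) = fun x => nu b * a x.
    apply/funext => x; rewrite mulrC -(functionalZ Hnu)//.
    by congr nu; apply/funext => y; rewrite mulr1.
  by rewrite (functionalZ Hnu)// (functionalZ Hmu)// mulrC.
have alg_fst a : cts (@conv X) a -> alg (fun z => a z.1).
  move=> ca; split=> [|k [ck hk]]; first exact: continuous_fst.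
  split=> [|a' b ca' cb]; first by apply: continuous_mul => //; exact: continuous_fst.
  rewrite -(hk (fun x => a' x * a x) b)//; last exact: continuous_mul.
  by congr T; apply/funext => z; ring.
have alg_snd b : cts (@conv Y) b -> alg (fun z => b z.2).
  move=> cb; split=> [|k [ck hk]]; first exact: continuous_snd.
  split=> [|a b' ca cb']; first by apply: continuous_mul => //; exact: continuous_snd.
  rewrite -(hk a (fun y => b' y * b y))//; last exact: continuous_mul.
  by congr T; apply/funext => z; ring.
apply: (functional_Stone_Weierstrass HT (alg := alg)) => //.
- by move=> g [].
- by move=> c; apply: (alg_fst (fun=> c)); exact: continuous_cst.
- move=> g h [cg hg] [ch hh]; split=> [|k Nk]; first exact: continuous_sub.
  have [cgk Tg] := hg k Nk; have [chk Th] := hh k Nk; have [ck _] := Nk.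
  split=> [|a b ca cb]; first by apply: continuous_mul => //; exact: continuous_sub.
  transitivity (T (fun z => a z.1 * b z.2 * (g z * k z)) -
      T (fun z => a z.1 * b z.2 * (h z * k z))); last by rewrite Tg// Th// subrr.
  rewrite -(functionalB HT); [|by apply: continuous_mul => //; exact: cab..].
  by congr T; apply/funext => z; ring.
- move=> g h [cg hg] [ch hh]; split=> [|k Nk]; first exact: continuous_mul.
  have -> : (fun z => g z * h z * k z) = fun z => g z * (h z * k z).
    by apply/funext => z; rewrite mulrA.
  exact: (hg _ (hh _ Nk)).
(* Multiplying [1], which lies in [N], by [g] and taking [a = b = 1] gives [T g = 0]. *)
- move=> g [cg hg]; have [_ hg1] := hg _ N1.
  rewrite -(hg1 (fun=> 1) (fun=> 1)); [|exact: continuous_cst..].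
  by congr T; apply/funext => z; ring.
- move=> [x y] [x' y'] fzw.
  have cfx y0 := continuous_section pair_continuous (@conv_pt Y) y0 cf.
  have cfy x0 := continuous_section pair_continuousC (@conv_pt X) x0 cf.
  (* Comparison through the corner [(x', y)]: the values of [f] differ along one of the two sides,
     and a bump in that variable alone separates the points. *)
  have [fxx|/eqP fxx] := pselect (f (x, y) = f (x', y)).
    have fyy : f (x', y) != f (x', y') by rewrite -fxx; apply/eqP.
    have [p [cp p01 py py']] := separating_bump (cfy x') fyy.
    exists (fun z => p z.2); split=> //; first exact: alg_snd.
      exact: (@neighborhood_snd (x, y) _ py).
    exact: (@neighborhood_snd (x', y') _ py').
  have [p [cp p01 px px']] := separating_bump (cfx y) fxx.
  exists (fun z => p z.1); split=> //; first exact: alg_fst.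
    exact: (@neighborhood_fst (x, y) _ px).
  exact: (@neighborhood_fst (x', y') _ px').
Qed.

End Fubini.

Lemma tensor_product (K : numFieldType) : tensor_product_property K.
Proof.
move=> X Y mu nu Hmu Hnu.
have pc := @pair_continuous X Y; have pcC := @pair_continuousC X Y.
split=> [f cf|].
  split; first exact: (continuous_partial pc (@conv_pt Y) Hmu cf).
  exact: (continuous_partial pcC (@conv_pt X) Hnu cf).
exists (fun f => nu (fun y => mu (fun x => f (x, y)))); split.
- exact: (iterated_functional pc (@conv_pt Y) Hmu Hnu).
- by move=> f cf; split=> //; exact: (fubini Hmu Hnu cf).
(* Uniqueness: the iterated formula prescribes every value on continuous functions. *)
- by move=> T' _ hT' f cf; have [] := hT' f cf.
Qed.

(* R ranges over the reals (any realType) and over its complexification R[i]. *)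
Theorem theorem1p1 (R : realType) :
  tensor_product_property R /\ tensor_product_property (complex R).
Proof. by split; exact: tensor_product. Qed.
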